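(* There exist $n\in\mathbb{N}$, a set $F\subset\mathbb{R}^n$ and a point $x\in\mathbb{R}^{n}$ such that $F$ has no approximate $1$-tangent at $x$ and \begin{itemize} \item $\mathcal{I}_{p}^{1}(F)<\infty$ for all $p\in(0,\infty)$, \item $\mathcal{M}_{p}^{1}(F)<\infty$ for all $p\in(0,\infty)$. \end{itemize}
   Context: $\mathcal{H}^1$ is the one-dimensional Hausdorff measure. For mutually distinct points $x,y,z$ let $r(x,y,z)\in(0,\infty]$ be the circumradius of the triangle with these vertices ($r=\infty$ if the points are collinear). Conventions: $1/0=\infty$, $1/\infty=0$, $\inf\emptyset=\infty$. For a set $X$ put $\kappa(x,y,z)=1/r(x,y,z)$ if $x,y,z\in X$ are mutually distinct and $0$ otherwise; $\kappa_i(x,y)=1/\inf_{w\in X\setminus\{x,y\}} r(x,y,w)$ if $x\neq y$ and $\kappa_i(x,x)=0$. For $p\in(0,\infty)$: $\mathcal{I}_p^{1}(X)=\int_X\int_X\kappa_i^p(x,y)\,d\mathcal{H}^1(x)d\mathcal{H}^1(y)$, $\mathcal{M}_p^{1}(X)=\int_X\int_X\int_X\kappa^p(x,y,z)\,d\mathcal{H}^1(x)d\mathcal{H}^1(y)d\mathcal{H}^1(z)$. For $s\in\mathbb{S}^{n-1}$, $\epsilon>0$ the open double cone is $C_{s,\epsilon}(x)=\{y\in\mathbb{R}^n\setminus\{x\}:\min\{\measuredangle(y,x,x-s),\measuredangle(y,x,x+s)\}<\epsilon\}$, where $\measuredangle(y,x,z)$ is the angle at $x$. A set $X\subset\mathbb{R}^n$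 has an approximate $1$-tangent at $x$ if there is $s\in\mathbb{S}^{n-1}$ such that $\lim_{r\downarrow0}\mathcal{H}^1([X\setminus C_{s,\epsilon}(x)]\cap\overline B_r(x))/(2r)=0$ for all $\epsilon>0$, where $\overline B_r(x)$ is the closed ball. *)

(* Defs.v *)
From HB Require Import structures.
From mathcomp Require Import all_boot all_order all_algebra.
From mathcomp Require Import all_classical all_reals all_analysis.
From mathcomp Require Import measurable_realfun.

Set Implicit Arguments.
Unset Strict Implicit.
Unset Printing Implicit Defensive.
Import Order.TTheory GRing.Theory Num.Theory.
Import numFieldNormedType.Exports.
Local Open Scope classical_set_scope.
Local Open Scope ring_scope.

(* The library norm of 'rV[R]_n is the sup norm, so the Euclidean structure is
   set up by hand. *)
Section euclidean.
Context (R : realType) (n : nat).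
Implicit Types (x y z c : 'rV[R]_n) (A : set 'rV[R]_n).

Definition dotv x y : R := \sum_(i < n) x 0 i * y 0 i.

Definition enorm x : R := Num.sqrt (dotv x x).

Definition edist x y : R := enorm (x - y).

Definition closed_eball x (r : R) : set 'rV[R]_n := [set y | edist y x <= r].

(* The value 0 is included so that the diameter of the empty set is 0. *)
Definition ediam A : \bar R :=
  ereal_sup ([set 0%E] `|` [set (edist p.1 p.2)%:E | p in A `*` A]).

(* The angle at the middle argument, in [0, pi], for y != x and z != x. *)
Definition angle y x z : R :=
  acos (dotv (y - x) (z - x) / (enorm (y - x) * enorm (z - x))).

(* The points of the affine hull of {x, y, z} equidistant from x, y and z. *)
Definition circumcenters x y z : set 'rV[R]_n :=
  [set c | (exists a b : R, c = x + a *: (y - x) + b *: (z - x)) /\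
           edist c x = edist c y /\ edist c y = edist c z].

(* For non-collinear points there is exactly one circumcenter; for mutually
   distinct collinear points there is none and the infimum is +oo. Only used
   at mutually distinct points. *)
Definition circumradius x y z : \bar R :=
  ereal_inf [set (edist c x)%:E | c in circumcenters x y z].

End euclidean.

Section hausdorff_measure.
Context (R : realType) (n : nat).
Implicit Types (A : set 'rV[R]_n) (delta : R).
Local Open Scope ereal_scope.

Definition delta_cover delta A : set ((set 'rV[R]_n)^nat) :=
  [set C | (forall k, ediam (C k) <= delta%:E) /\ A `<=` \bigcup_k C k].

Definition hausdorff1_delta delta A : \bar R :=
  ereal_inf [set \sum_(k <oo) ediam (C k) | C in delta_cover delta A].

Definition hausdorff1 A : \bar R :=
  ereal_sup [set hausdorff1_delta delta A | delta in [set d : R | (0 < d)%R]].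

Lemma ediam_ge0 A : 0 <= ediam A.
Proof. by apply: ereal_sup_ubound; left. Qed.

Lemma ediam0 : ediam (set0 : set 'rV[R]_n) = 0.
Proof.
apply/eqP; rewrite eq_le ediam_ge0 andbT.
by apply: ge_ereal_sup => _ [->//|[p [[]]]].
Qed.

Lemma hausdorff1_delta_ge0 delta A : 0 <= hausdorff1_delta delta A.
Proof.
apply: le_ereal_inf_tmp => _ [C _ <-].
by apply: nneseries_ge0 => k _ _; exact: ediam_ge0.
Qed.

Lemma le_hausdorff1_delta delta :
  {homo hausdorff1_delta delta : A B / A `<=` B >-> A <= B}.
Proof.
move=> A B AB; apply/ereal_inf_le_tmp => _ [C [dC BC] <-].
by exists C => //; split => //; exact: subset_trans BC.
Qed.

Lemma hausdorff1_delta0 delta : (0 < delta)%R ->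
  hausdorff1_delta delta set0 = 0.
Proof.
move=> d0; apply/eqP; rewrite eq_le hausdorff1_delta_ge0 andbT.
apply: ereal_inf_lbound; exists (fun=> set0).
  by split => // k; rewrite ediam0 lee_fin ltW.
by rewrite eseries0// => i _ _; exact: ediam0.
Qed.

Lemma hausdorff1_delta_sigma_subadditive delta :
  sigma_subadditive (hausdorff1_delta delta).
Proof.
move=> A.
have [[i ioo]|] := pselect (exists i, hausdorff1_delta delta (A i) = +oo).
  rewrite (eseries_pinfty _ _ ioo) ?leey// => k _.
  by rewrite -ltNye (lt_le_trans _ (hausdorff1_delta_ge0 _ _)).
rewrite -forallNE => Aoo.
suff add2e (e : {posnum R}) : hausdorff1_delta delta (\bigcup_k A k) <=
    \sum_(i <oo) hausdorff1_delta delta (A i) + e%:num%:E.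
  by apply/lee_addgt0Pr => _/posnumP[].
rewrite (le_trans _ (epsilon_trick _ _ _))//; last first.
  by move=> k; exact: hausdorff1_delta_ge0.
pose P k (B : (set 'rV[R]_n)^nat) := delta_cover delta (A k) B /\
  \sum_(j <oo) ediam (B j) <=
  hausdorff1_delta delta (A k) + (e%:num / (2 ^ k.+1)%:R)%:E.
have [G PG] : {G : ((set 'rV[R]_n)^nat)^nat & forall k, P k (G k)}.
  apply: (@choice _ _ P) => k.
  have en1 : (0 < e%:num / (2 ^ k.+1)%:R :> R)%R by [].
  have fin : hausdorff1_delta delta (A k) \is a fin_num.
    by rewrite ge0_fin_numE ?hausdorff1_delta_ge0// ltey; apply/eqP.
  have [_ [B dB <-] lt] := lb_ereal_inf_adherent en1 fin.
  by exists B; split => //; exact/ltW.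
pose m := @ediam R n.
have mG_ge0 x : 0 <= (m \o uncurry G) x by exact: ediam_ge0.
apply: (@le_trans _ _ (\esum_(i in setT) (m \o uncurry G) i)).
  apply: ereal_inf_lbound => /=.
  have /card_esym/ppcard_eqP[f] := card_nat2.
  exists (uncurry G \o f).
    split => [i|]; first by rewrite /= /uncurry; case: (f i) => a b; exact: (PG a).1.1.
    move=> t [i _ /(PG i).1.2[j _ Gt]].
    by exists (f^-1%FUN (i, j)) => //=; rewrite invK ?inE.
  rewrite -(esum_pred_image (m \o uncurry G) _ xpredT) ?[fun=> _]set_true//.
  by rewrite image_eq.
rewrite (_ : esum _ _ = \sum_(i <oo) \sum_(j <oo) m (G i j)); last first.
  pose J : nat -> set (nat * nat) := fun i => [set (i, j) | j in setT].
  rewrite (_ : setT = \bigcup_k J k); last first.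
    by rewrite predeqE => -[a b]; split => // _; exists a => //; exists b.
  rewrite esum_bigcupT /=; last 2 first.
    - apply/trivIsetP => i j _ _ ij.
      rewrite predeqE => -[a b] /=; split => //= -[] [_] _ [<- _].
      by move=> [b'] _ [] /esym/eqP; rewrite (negbTE ij).
    - by move=> /= [a b]; exact: ediam_ge0.
  rewrite -(image_id [set: nat]) -fun_true esum_pred_image//; last first.
    by move=> k _; apply: esum_ge0 => x _; exact: mG_ge0.
  apply: eq_eseriesr => /= j _.
  rewrite -(esum_pred_image (m \o uncurry G) (pair j) predT)//=; last first.
    - by move=> ? ? _ _; exact: (@can_inj _ _ _ snd).
    - by move=> k _; exact: ediam_ge0.
  by congr esum; rewrite predeqE => -[a b]; split; move=> [i _ <-]; exists i.
apply: lee_nneseries => [i _ _|i _]; last exact: (PG i).2.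
by apply: nneseries_ge0 => j _ _; exact: ediam_ge0.
Qed.

Lemma hausdorff1_ge0 A : 0 <= hausdorff1 A.
Proof.
apply: le_trans (hausdorff1_delta_ge0 1 A) _.
by apply: ereal_sup_ubound; exists 1%R => //=; exact: ltr01.
Qed.

Lemma hausdorff1_0 : hausdorff1 set0 = 0.
Proof.
apply/eqP; rewrite eq_le hausdorff1_ge0 andbT.
by apply: ge_ereal_sup => _ [d d0 <-]; rewrite hausdorff1_delta0.
Qed.

Lemma le_hausdorff1 : {homo hausdorff1 : A B / A `<=` B >-> A <= B}.
Proof.
move=> A B AB; apply: ge_ereal_sup => _ [d d0 <-].
apply: le_trans (le_hausdorff1_delta d AB) _.
by apply: ereal_sup_ubound; exists d.
Qed.

Lemma hausdorff1_sigma_subadditive : sigma_subadditive hausdorff1.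
Proof.
move=> A; apply: ge_ereal_sup => _ [d d0 <-].
apply: le_trans (hausdorff1_delta_sigma_subadditive d A) _.
apply: lee_nneseries => [i _ _|i _]; first exact: hausdorff1_delta_ge0.
by apply: ereal_sup_ubound; exists d.
Qed.

HB.instance Definition _ := isOuterMeasure.Build R 'rV[R]_n hausdorff1
  hausdorff1_0 hausdorff1_ge0 le_hausdorff1 hausdorff1_sigma_subadditive.

End hausdorff_measure.

(* Upper integral over X of a nonnegative function. Neither X nor f has to be
   measurable; the library integral of a non-measurable function is a lower
   integral, for which a finiteness claim would be too weak. *)
Section upper_integral.
Context d (T : measurableType d) (R : realType).
Variable mu : {measure set T -> \bar R}.
Local Open Scope ereal_scope.

Definition upper_integral (X : set T) (f : T -> \bar R) : \bar R :=
  ereal_inf [set \int[mu]_x g x | g in [set g : T -> \bar R |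
    [/\ measurable_fun setT g, forall x, 0 <= g x & forall x, X x -> f x <= g x]]].

Lemma upper_integralE (X : set T) (f : T -> \bar R) :
  measurable X -> measurable_fun X f -> (forall x, X x -> 0 <= f x) ->
  upper_integral X f = \int[mu]_(x in X) f x.
Proof.
move=> mX mf f0; apply/eqP; rewrite eq_le; apply/andP; split.
  apply: ereal_inf_lbound; exists (f \_ X); last by rewrite -integral_mkcond.
  split; first exact/(measurable_restrictT _ mX).1.
    by move=> x; rewrite erestrict_ge0.
  by move=> x Xx; rewrite patchE mem_set.
apply: le_ereal_inf_tmp => _ [g [mg g0 fg] <-].
apply: (@le_trans _ _ (\int[mu]_(x in X) g x)).
  by apply: ge0_le_integral => //; exact: measurable_funTS.
by apply: ge0_subset_integral.
Qed.

End upper_integral.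

(* Upper integral with respect to an outer measure mu, i.e. with respect to the
   restriction of mu to its Caratheodory-measurable sets. *)
Definition outer_integral (R : realType) (T : pointedType)
    (mu : {outer_measure set T -> \bar R}) (X : set T) (f : T -> \bar R) :
    \bar R :=
  upper_integral (mu : set (caratheodory_type mu) -> \bar R) X f.

Section curvature_energies.
Context (R : realType) (n : nat).
Implicit Types (X : set 'rV[R]_n) (x y z : 'rV[R]_n) (p : R).
Local Open Scope ereal_scope.

(* In \bar R the library has 0^-1 = +oo and +oo^-1 = 0. *)
Definition kappa X x y z : \bar R :=
  if `[< [/\ X x, X y & X z] /\ [/\ x <> y, y <> z & x <> z] >]
  then (circumradius x y z)^-1 else 0.

Definition kappa_i X x y : \bar R :=
  if x == y then 0
  else (ereal_inf [set circumradius x y w | w in X `\` [set x; y]])^-1.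

Definition energy_I p X : \bar R :=
  outer_integral (@hausdorff1 R n) X (fun y =>
    outer_integral (@hausdorff1 R n) X (fun x => kappa_i X x y `^ p)).

Definition energy_M p X : \bar R :=
  outer_integral (@hausdorff1 R n) X (fun z =>
    outer_integral (@hausdorff1 R n) X (fun y =>
      outer_integral (@hausdorff1 R n) X (fun x => kappa X x y z `^ p))).

End curvature_energies.

Section approximate_tangent.
Context (R : realType) (n : nat).
Implicit Types (X : set 'rV[R]_n) (x s : 'rV[R]_n) (eps : R).

Definition double_cone s eps x : set 'rV[R]_n :=
  [set y | y <> x /\ Num.min (angle y x (x - s)) (angle y x (x + s)) < eps].

Definition has_approx_tangent X x : Prop :=
  exists s, enorm s = 1 /\ forall eps, 0 < eps ->
    (hausdorff1 ((X `\` double_cone s eps x) `&` closed_eball x r)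
       / (2 * r)%:E)%E @[r --> 0^'+] --> 0%E.

End approximate_tangent.

(* Main.v *)
(** Let the scales a_0 > a_1 > ... decrease to 0 so fast that a_(k+1) <= (a_k / 4)^(k+2),
    and let F be the union of the segments [a_k, 2 a_k] placed on the first coordinate
    axis for even k and on the second one for odd k. At every scale r = 2 a_k the ball of
    radius r around 0 contains a whole segment, alternately on either axis; a double
    cone cannot be close to both axes, so there is no approximate tangent at 0.

    On the other hand, let x and y lie in the j-th and the k-th segment and let c be
    equidistant from x, y and a third point w of F. If two of the points lie in
    different segments, the distance to c is at least of the order of the larger of
    their two scales. The only other bound is needed when x and y lie in the k-th
    segment and w lies nearer to 0 on the other axis, where an explicit computation
    gives |c| >= a_k^2 / (4 a_(k+1)) >= 1/4. Hence the curvatures are at most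
    (4 / a_(j-1)) (4 / a_(k-1)), a product of a function of x and a function of y, all of
    whose powers have finite integral because the series with general term
    (4 / a_(k-1))^m a_k converges for every m. *)
From Pilot Require Import Defs.
From mathcomp Require Import all_boot all_order all_algebra.
From mathcomp Require Import all_classical all_reals all_analysis.
From mathcomp Require Import measurable_realfun ring lra zify.
(* Imported again because all_analysis has an unrelated edist. *)
Import Pilot.Defs.
Import Order.TTheory GRing.Theory Num.Theory.
Import numFieldNormedType.Exports.
Local Open Scope classical_set_scope.
Local Open Scope ring_scope.

(** * Points on the coordinate axes *)

Lemma coord_le_edist {R : realType} {n : nat} (x y : 'rV[R]_n) (i : 'I_n) :
  `|x 0 i - y 0 i| <= edist x y.
Proof.
rewrite /edist /enorm /dotv -sqrtr_sqr ler_wsqrtr// (bigD1 i)//= !mxE -expr2.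
by rewrite lerDl sumr_ge0// => j _; rewrite -expr2 sqr_ge0.
Qed.

Lemma coord_ler_edist {R : realType} {n : nat} (x y : 'rV[R]_n) (i : 'I_n) :
  x 0 i <= y 0 i + edist x y.
Proof. by have := coord_le_edist x y i; rewrite ler_norml => /andP[]; lra. Qed.

Lemma edistC {R : realType} {n : nat} (x y : 'rV[R]_n) : edist x y = edist y x.
Proof.
rewrite /edist /enorm /dotv; congr Num.sqrt; apply: eq_bigr => i _.
by rewrite !mxE; ring.
Qed.

Lemma dist_coord_le {R : realType} {n : nat} (x y c : 'rV[R]_n) (i : 'I_n) :
  edist c x = edist c y -> `|x 0 i - y 0 i| <= 2 * edist c x.
Proof.
move=> cxy; have := coord_le_edist c x i; have := coord_le_edist c y i.
rewrite -cxy; set d := edist _ _; rewrite !ler_norml => /andP[? ?] /andP[? ?].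
by apply/andP; split; lra.
Qed.

Lemma dotv2 {R : realType} (x y : 'rV[R]_2) (i : 'I_2) :
  dotv x y = x 0 i * y 0 i + x 0 (rev_ord i) * y 0 (rev_ord i).
Proof.
rewrite /dotv (bigD1 i)//=; congr (_ + _); apply: big_pred1 => j /=.
by case: i j => [[|[|//]] ?] [[|[|//]] ?].
Qed.

Lemma edist2 {R : realType} (x y : 'rV[R]_2) (i : 'I_2) :
  edist x y ^+ 2 = (x 0 i - y 0 i) ^+ 2 + (x 0 (rev_ord i) - y 0 (rev_ord i)) ^+ 2.
Proof.
have := dotv2 (x - y) (x - y) i; rewrite !mxE -!expr2 => xy.
by rewrite /edist /enorm sqr_sqrtr// xy addr_ge0 ?sqr_ge0.
Qed.

Lemma rev_ord_neq (i j : 'I_2) : i != j -> rev_ord i = j.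
Proof. by case: i j => [[|[|//]] ?] [[|[|//]] ?] => // _; apply: val_inj. Qed.

Lemma row2P {R : realType} (x y : 'rV[R]_2) (i : 'I_2) :
  x 0 i = y 0 i -> x 0 (rev_ord i) = y 0 (rev_ord i) -> x = y.
Proof.
move=> xyi xyi'; apply/rowP => j.
by have [<-//|/rev_ord_neq<-] := eqVneq i j.
Qed.

(** * Scales and the segments built on them *)

Definition axis_segment {R : realType} (i : 'I_2) (a : R) : set 'rV[R]_2 :=
  [set x | a <= x 0 i <= 2 * a /\ x 0 (rev_ord i) = 0].

(* With the a_k of the header, [scale k.+1] is a_k and [scale 0 = 1] plays a_(-1). *)
Fixpoint scale {R : realType} (k : nat) : R :=
  if k is k'.+1 then (scale k' / 4) ^+ k'.+1 else 1.

Lemma scale_bounds {R : realType} k : 0 < scale k :> R /\ scale k <= 4^-1 ^+ k :> R.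
Proof.
elim: k => [|k [k0 k1]] /=; first by rewrite expr0.
have s1 : scale k <= 1 :> R by rewrite (le_trans k1)// exprn_ile1//; lra.
split; first by rewrite exprn_gt0//; lra.
rewrite exprS exprSr; apply: (@le_trans _ _ (scale k / 4 * 1)); last by lra.
rewrite ler_pM ?exprn_ge0 ?exprn_ile1//; lra.
Qed.

Lemma scale_gt0 {R : realType} k : 0 < scale k :> R.
Proof. by have [] := @scale_bounds R k. Qed.

Lemma scale_le1 {R : realType} k : scale k <= 1 :> R.
Proof.
by have [_ /le_trans->//] := @scale_bounds R k; rewrite exprn_ile1//; lra.
Qed.

Lemma scaleS_le {R : realType} k : scale k.+1 <= scale k / 4 :> R.
Proof.
have := @scale_gt0 R k; have := @scale_le1 R k => s1 s0 /=.
rewrite exprS; apply: (@le_trans _ _ (scale k / 4 * 1)); last by lra.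
rewrite ler_pM ?exprn_ge0 ?exprn_ile1//; lra.
Qed.

(** Two of the [k.+2] factors already give the square, and the others are at most 1. This gap
    handles a third point nearer to 0 on the other axis. *)
Lemma scaleSS_le {R : realType} k : scale k.+2 <= scale k.+1 ^+ 2 :> R.
Proof.
have := @scale_gt0 R k.+1; have := @scale_le1 R k.+1 => s1 s0.
rewrite [leLHS]/= -/(scale k.+1) -[k.+2]add2n exprD.
rewrite -[leRHS]mulr1 ler_pM ?exprn_ge0 ?exprn_ile1 //; try lra.
by rewrite lerXn2r ?nnegrE; lra.
Qed.

Lemma scale_le {R : realType} {j k : nat} : (j <= k)%N -> scale k <= scale j :> R.
Proof.
elim: k => [|k IH]; first by rewrite leqn0 => /eqP->.
rewrite leq_eqVlt => /predU1P[->//|/IH]; apply: le_trans.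
by apply: le_trans (scaleS_le k) _; have := @scale_gt0 R k; lra.
Qed.

Lemma scale_le_inv {R : realType} k : scale k <= k.+1%:R^-1 :> R.
Proof.
elim: k => [|k IH]; first by rewrite invr1.
apply: (le_trans (scaleS_le k)); apply: (@le_trans _ _ (k.+1%:R^-1 / 4)).
  by rewrite ler_pM2r// invr_gt0; lra.
rewrite -invfM lef_pV2 ?posrE ?ltr0n ?mulr_gt0 ?ltr0n//.
by rewrite -natrM ler_nat; lia.
Qed.

Definition axis (k : nat) : 'I_2 := if odd k then ord_max else ord0.

Definition piece {R : realType} (k : nat) : set 'rV[R]_2 :=
  axis_segment (axis k) (scale k.+1).

Lemma piece_coordE {R : realType} {k : nat} {x : 'rV[R]_2} {i : 'I_2} :
  piece k x -> axis k != i -> x 0 i = 0.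
Proof. by move=> [_ xi] /rev_ord_neq<-. Qed.

Lemma piece_coord_le {R : realType} {k : nat} {x : 'rV[R]_2} (i : 'I_2) :
  piece k x -> x 0 i <= 2 * scale k.+1.
Proof.
move=> kx; have [<-|/(piece_coordE kx)->] := eqVneq (axis k) i.
  by case: kx => /andP[].
by have := @scale_gt0 R k.+1; lra.
Qed.

(** On the axis of [x], whichever axis [y] lies on, the coordinates differ by at least [scale j.+1 -
    2 * scale k.+1 >= scale k / 2]; half of this is forced on the distance to [c]. *)
Lemma circumradius_pieces_lt {R : realType} {j k : nat} {x y c : 'rV[R]_2} :
  (j < k)%N -> piece j x -> piece k y -> edist c x = edist c y ->
  scale k / 4 <= edist c x.
Proof.
move=> jk jx ky /(dist_coord_le _ _ _ (axis j)).
have := piece_coord_le (axis j) ky; case: jx => /andP[jx _] _.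
have := @scale_le R _ _ jk; have := @scaleS_le R k.
by rewrite ler_norml => ? ? ? /andP[_]; lra.
Qed.

Lemma circumradius_piece_eq {R : realType} {j l : nat} {x y w c : 'rV[R]_2} :
  piece j x -> piece j y -> piece l w ->
  x <> y -> y <> w -> x <> w ->
  edist c x = edist c y -> edist c y = edist c w ->
  scale j / 4 <= edist c x.
Proof.
move=> jx jy lw xy yw xw cxy cyw.
have [lj|jl] := ltnP l j.
  rewrite cxy cyw; apply: (circumradius_pieces_lt lj lw jx).
  by rewrite -cyw.
have := congr1 (fun u => u ^+ 2) cxy; have := congr1 (fun u => u ^+ 2) cyw.
set i := axis j; rewrite !(edist2 _ _ i).
have [/andP[ax _] x'] := jx; have [/andP[ay _] y'] := jy.
rewrite -/i in ax ay x' y'.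
have xyi : x 0 i != y 0 i.
  by apply/eqP => xyi; apply: xy; apply: (row2P _ _ _ xyi); rewrite x' y'.
move=> E1 E2.
(* Both points have second coordinate 0, so subtracting the squared distances leaves a multiple of
   [x 0 i - y 0 i]: [c] lies on the perpendicular bisector. *)
have cE : 2 * c 0 i = x 0 i + y 0 i.
  have : (x 0 i - y 0 i) * (2 * c 0 i - x 0 i - y 0 i) = 0.
    by rewrite x' y' in E2; lra.
  by move/eqP; rewrite mulf_eq0 subr_eq0 (negbTE xyi) /= => /eqP; lra.
(* On a common axis the three points are collinear: [c] would project to the midpoint of [x], [y]
   and of [y], [w], which forces [x = w]. *)
have [il|il] := eqVneq i (axis l).
  have w' : w 0 (rev_ord i) = 0 by case: lw => _; rewrite -il.
  have ywi : y 0 i != w 0 i.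
    by apply/eqP => ywi; apply: yw; apply: (row2P _ _ _ ywi); rewrite w' y'.
  have : (y 0 i - w 0 i) * (2 * c 0 i - y 0 i - w 0 i) = 0.
    by rewrite w' y' in E1; lra.
  move/eqP; rewrite mulf_eq0 subr_eq0 (negbTE ywi) /= => /eqP cE'.
  by exfalso; apply: xw; apply: (row2P _ _ i); [lra|rewrite x' w'].
have {}jl : (j < l)%N.
  by rewrite ltn_neqAle jl andbT; apply: contraNneq il; rewrite /i => ->.
have wi : w 0 i = 0 by apply: (piece_coordE lw); rewrite eq_sym.
have rE := rev_ord_neq _ _ il.
have [/andP[w1 w2] _] := lw.
rewrite -rE in w1 w2.
have cw : 2 * c 0 (rev_ord i) * w 0 (rev_ord i) =
    x 0 i * y 0 i + w 0 (rev_ord i) ^+ 2.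
  by rewrite wi y' in E1; nra.
have s0 := @scale_gt0 R l.+1.
have sl : scale l.+1 <= scale j.+1 ^+ 2 :> R.
  by apply: le_trans (scaleSS_le j); apply: scale_le.
have sj := @scale_gt0 R j.+1.
have aa : scale j.+1 ^+ 2 <= x 0 i * y 0 i by rewrite expr2 ler_pM// ltW.
(* In [cw] the product [x 0 i * y 0 i] is at least [scale l.+1], hence at least half of the off-axis
   coordinate of [w]; dividing by that coordinate gives the bound. *)
have c4 : 1 <= 4 * c 0 (rev_ord i).
  suff : w 0 (rev_ord i) <= 4 * c 0 (rev_ord i) * w 0 (rev_ord i).
    by rewrite -[leLHS]mul1r ler_pM2r//; lra.
  have : 0 <= w 0 (rev_ord i) ^+ 2 by rewrite sqr_ge0.
  by lra.
have := coord_ler_edist c x (rev_ord i); rewrite x'.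
have := @scale_le1 R j; lra.
Qed.

(** Each case bounds the distance below by one of the two factors, and the other factor is at most
    1. The product form separates the variables in the energies. *)
Lemma circumradius_pieces {R : realType} {j k l : nat} {x y w c : 'rV[R]_2} :
  piece j x -> piece k y -> piece l w ->
  x <> y -> y <> w -> x <> w ->
  edist c x = edist c y -> edist c y = edist c w ->
  scale j / 4 * (scale k / 4) <= edist c x.
Proof.
move=> jx ky lw xy yw xw cxy cyw.
have := @scale_gt0 R j; have := @scale_le1 R j.
have := @scale_gt0 R k; have := @scale_le1 R k => ? ? ? ?.
have [jk|kj|jk] := ltngtP j k.
- by apply: le_trans (circumradius_pieces_lt jk jx ky cxy); nra.
- rewrite cxy; apply: le_trans (circumradius_pieces_lt kj ky jx _) => //; nra.
- rewrite -jk in ky *.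
  by apply: le_trans (circumradius_piece_eq jx ky lw xy yw xw cxy cyw); nra.
Qed.

(** * One-dimensional Hausdorff measure *)

Lemma edist_le_ediam {R : realType} {n : nat} {A : set 'rV[R]_n} {x y : 'rV[R]_n} :
  A x -> A y -> ((edist x y)%:E <= ediam A)%E.
Proof. by move=> Ax Ay; apply: ereal_sup_ubound; right; exists (x, y). Qed.

Lemma ediam_le {R : realType} {n : nat} {A : set 'rV[R]_n} {d : R} : 0 <= d ->
  (forall x y, A x -> A y -> edist x y <= d) -> (ediam A <= d%:E)%E.
Proof.
move=> d0 Ad; apply: ge_ereal_sup => _ [->|[[x y] [Ax Ay] <-]]; rewrite lee_fin//.
exact: Ad.
Qed.

Lemma hausdorff1_delta_anti {R : realType} {n : nat} {A : set 'rV[R]_n} {d e : R} :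
  d <= e -> (hausdorff1_delta e A <= hausdorff1_delta d A)%E.
Proof.
move=> de; apply: ereal_inf_le_tmp => _ [C [dC AC] <-]; exists C => //; split => // k.
by rewrite (le_trans (dC k))// lee_fin.
Qed.

Lemma hausdorff1_delta_le {R : realType} {n : nat} {A : set 'rV[R]_n} {d : R} :
  0 < d -> (hausdorff1_delta d A <= hausdorff1 A)%E.
Proof. by move=> d0; apply: ereal_sup_ubound; exists d. Qed.

(** No set of diameter at most [d] meets both [A] and [B], so the members of a cover that meet [A]
    cover [A] and the remaining ones cover [B]. *)
Lemma hausdorff1_delta_separated {R : realType} {n : nat} (A B : set 'rV[R]_n) (d : R) :
  0 < d -> (forall x y, A x -> B y -> d < edist x y) ->
  (hausdorff1_delta d A + hausdorff1_delta d B <= hausdorff1_delta d (A `|` B))%E.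
Proof.
move=> d0 AB; apply: le_ereal_inf_tmp => _ [C [dC ABC] <-].
pose meets k := `[< C k `&` A !=set0 >].
pose CA k := if meets k then C k else set0.
pose CB k := if meets k then set0 else C k.
have -> : (\sum_(k <oo) ediam (C k) =
    \sum_(k <oo) ediam (CA k) + \sum_(k <oo) ediam (CB k))%E.
  rewrite -nneseriesD; [|by move=> *; exact: ediam_ge0..].
  by apply: eq_eseriesr => k _; rewrite /CA /CB; case: ifP; rewrite ediam0 ?adde0 ?add0e.
apply: leeD; apply: ereal_inf_lbound.
  exists CA => //; split=> [k|x Ax].
    by rewrite /CA; case: ifP => // _; rewrite ediam0 lee_fin ltW.
  have [|k _ Cx] := ABC x; first by left.
  by exists k => //; rewrite /CA /meets ifT//; apply/asboolP; exists x.
exists CB => //; split=> [k|y By].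
  by rewrite /CB; case: ifP => // _; rewrite ediam0 lee_fin ltW.
have [|k _ Cy] := ABC y; first by right.
exists k => //; rewrite /CB /meets; case: asboolP => // -[x [Cx Ax]].
have := AB _ _ Ax By; rewrite ltNge => /negP; apply.
by rewrite -lee_fin (le_trans (edist_le_ediam Cx Cy)).
Qed.

Lemma hausdorff1_separated {R : realType} {n : nat} (A B : set 'rV[R]_n) (e : R) :
  0 < e -> (forall x y, A x -> B y -> e <= edist x y) ->
  (hausdorff1 A + hausdorff1 B <= hausdorff1 (A `|` B))%E.
Proof.
move=> e0 AB; set M := hausdorff1 (A `|` B).
have [->|] := eqVneq M +oo%E; first exact: leey.
rewrite -ltey => Moo.
(* Independent meshes for [A] and [B] allow the two suprema to be taken one after the other. The
   common mesh is at most [e / 2] to make the separation strict. *)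
have Md d1 d2 : 0 < d1 -> 0 < d2 ->
    (hausdorff1_delta d1 A + hausdorff1_delta d2 B <= M)%E.
  move=> d10 d20; pose d := Num.min (Num.min d1 d2) (e / 2).
  have d0 : 0 < d by rewrite !lt_min d10 d20 /=; lra.
  have [de1 de2] : d <= Num.min d1 d2 /\ d <= e / 2.
    by split; rewrite /d ge_min lexx ?orbT.
  apply: le_trans (hausdorff1_delta_le d0).
  apply: le_trans (hausdorff1_delta_separated _ _ _ d0 _).
    by apply: leeD; apply: hausdorff1_delta_anti; apply: (le_trans de1);
      rewrite ge_min lexx ?orbT.
  by move=> x y Ax By; have := AB _ _ Ax By; lra.
have fB d : 0 < d -> hausdorff1_delta d B \is a fin_num.
  move=> d0; rewrite ge0_fin_numE ?hausdorff1_delta_ge0// (le_lt_trans _ Moo)//.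
  apply: le_trans (Md 1 d ltr01 d0).
  by rewrite leeDr// hausdorff1_delta_ge0.
have AM d : 0 < d -> (hausdorff1 A <= M - hausdorff1_delta d B)%E.
  by move=> d0; apply: ge_ereal_sup => _ [d' d'0 <-]; rewrite leeBrDr ?fB// Md.
have fA : hausdorff1 A \is a fin_num.
  rewrite ge0_fin_numE ?hausdorff1_ge0// (le_lt_trans _ Moo)//.
  by apply: le_hausdorff1 => x; left.
rewrite addeC -leeBrDr//; apply: ge_ereal_sup => _ [d d0 <-].
by rewrite leeBrDr// addeC -leeBrDr ?fB// AM.
Qed.

(* The missing point is H(X `&` [f > 0]) <= sup_(s > 0) H(X `&` [f > s]) =: L. For
   s_j decreasing to 0, the layer [s_j+2 < f <= s_j+1] is at positive distance from
   [f > s_j], so its measure is at most L - H(X `&` [f > s_j]), which is summable with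
   a small sum if the s_j decrease fast enough. *)
Lemma sublevel_caratheodory {R : realType} {n : nat} (f : 'rV[R]_n -> R) :
  (forall x y, f x <= f y + edist x y) ->
  (@hausdorff1 R n).-caratheodory [set x | f x <= 0].
Proof.
move=> lipf; apply: le_caratheodory_measurable => X /=.
have [->|] := eqVneq (hausdorff1 X) +oo%E; first exact: leey.
rewrite -ltey => Xoo.
pose E s := X `&` [set x | s < f x].
have finX B : B `<=` X -> hausdorff1 B \is a fin_num.
  move=> BX; rewrite ge0_fin_numE ?hausdorff1_ge0// (le_lt_trans _ Xoo)//.
  exact: le_hausdorff1.
have EX s : E s `<=` X by move=> x [].
have leE s t : s <= t -> (hausdorff1 (E t) <= hausdorff1 (E s))%E.
  by move=> st; apply: le_hausdorff1 => x [Xx /= tx]; split=> //=; apply: le_lt_trans tx.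
have -> : X `&` ~` [set x | f x <= 0] = E 0.
  by congr (_ `&` _); apply/seteqP; split => x /=; [move/negP; rewrite -ltNge|
    rewrite ltNge => /negP].
pose L := ereal_sup [set hausdorff1 (E s) | s in [set s | 0 < s]].
have LE s : 0 < s -> (hausdorff1 (E s) <= L)%E.
  by move=> s0; apply: ereal_sup_ubound; exists s.
have LX : (L <= hausdorff1 X)%E.
  by apply: ge_ereal_sup => _ [s s0 <-]; apply: le_hausdorff1.
have L0 : (0 <= L)%E by apply: le_trans (LE 1 ltr01); exact: hausdorff1_ge0.
have Lfin : L \is a fin_num by rewrite ge0_fin_numE// (le_lt_trans LX).
have finX0 : hausdorff1 (X `&` [set x | f x <= 0]) \is a fin_num.
  by apply: finX => x [].
have X0L : (hausdorff1 (X `&` [set x | (f x <= 0)%R]) + L <= hausdorff1 X)%E.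
  rewrite addeC -leeBrDr//; apply: ge_ereal_sup => _ [s s0 <-].
  rewrite leeBrDr// addeC.
  apply: (le_trans (hausdorff1_separated _ _ _ s0 _)).
    by move=> x y [_ /= fx] [_ /= fy]; have := lipf y x; rewrite edistC; lra.
  by apply: le_hausdorff1 => x [[]|[]].
apply: le_trans X0L; apply: leeD => //; apply/lee_addgt0Pr => e e0.
pose P j t := [/\ 0 < t, t <= j.+1%:R^-1 &
  (L - (e / (2 ^ j.+1)%:R)%:E < hausdorff1 (E t))%E].
have [r rP] : {r : nat -> R & forall j, P j (r j)}.
  apply: (@choice _ _ P) => j.
  have ej : 0 < e / (2 ^ j.+1)%:R by rewrite divr_gt0// ltr0n expn_gt0.
  have [_ [t t0 <-] tL] := ub_ereal_sup_adherent ej Lfin.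
  exists (Num.min t j.+1%:R^-1); split; last 1 first.
  - by rewrite (lt_le_trans tL)// leE// ge_min lexx.
  - by rewrite lt_min invr_gt0 ltr0n/= andbT.
  - by rewrite ge_min lexx orbT.
(* Halving makes [s] strictly decreasing, so successive gaps are positive; the minimum with [r]
   preserves the convergence to 0 and the closeness to [L]. *)
pose s := nat_rect (fun=> R) (r 0%N) (fun j t => Num.min (t / 2) (r j.+1)).
have s0 j : 0 < s j.
  elim: j => [|j IH] /=; first by have [] := rP 0%N.
  by rewrite lt_min divr_gt0//=; have [] := rP j.+1.
have sr j : s j <= r j by case: j => [|j] //=; rewrite ge_min lexx orbT.
have sS j : s j.+1 < s j.
  by rewrite /= gt_min ltr_pdivrMr// mulr2n mulrDr mulr1 ltrDl s0.
pose layer j := X `&` [set x | s j.+2 < f x <= s j.+1].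
have layerL j : (hausdorff1 (layer j) <= (e / (2 ^ j.+1)%:R)%:E)%E.
  have : (hausdorff1 (layer j) + hausdorff1 (E (s j)) <= L)%E.
    apply: le_trans (LE _ (s0 j.+2)).
    have sj : 0 < s j - s j.+1 by rewrite subr_gt0.
    apply: (le_trans (hausdorff1_separated _ _ _ sj _)).
      by move=> x y [_ /= /andP[_ fx]] [_ /= fy]; have := lipf y x; rewrite edistC; lra.
    apply: le_hausdorff1 => x [[Xx /= /andP[] //]|[Xx /= xj]]; split => //=.
    by apply: lt_trans xj; apply: (lt_trans (sS j.+1)).
  have : (L - (e / (2 ^ j.+1)%:R)%:E <= hausdorff1 (E (s j)))%E.
    by have [_ _ /ltW/le_trans] := rP j; apply; apply: leE.
  have /fineK <- := finX _ (EX (s j)).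
  have /fineK <- : hausdorff1 (layer j) \is a fin_num by apply: finX => x [].
  have /fineK <- := Lfin.
  by rewrite -EFinN -!EFinD !lee_fin; lra.
have cover : E 0 `<=` E (s 1%N) `|` \bigcup_j layer j.
  move=> x [Xx /= fx].
  have [k kx] : exists k, s k < f x.
    have [k] := ltr_add_invr fx; rewrite add0r => kx; exists k.
    by apply: le_lt_trans kx; apply: (le_trans (sr k)); have [] := rP k.
  have ex : exists k, s k < f x by exists k.
  (* The least index [k] with [s k < f x] is [j.+2] exactly on [layer j]; indices 0 and 1 fall into
     [E (s 1)]. *)
  case: (ex_minnP ex) => -[|[|j]] jx jmin.
  - by left; split => //=; exact: lt_trans (sS 0%N) jx.
  - by left.
  - right; exists j => //; split => //=; rewrite jx leNgt.
    by apply/negP => /(jmin j.+1); rewrite ltnn.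
apply: (le_trans (le_hausdorff1 cover)).
apply: (le_trans (outer_measureU2 _ _ _)); apply: leeD; first exact: LE.
apply: (le_trans (outer_measure_sigma_subadditive _ _)).
have := @epsilon_trick R (fun=> 0%E) e predT (fun=> lexx _) (ltW e0).
rewrite [X in (_ <= X + _)%E]eseries0// add0e; apply: le_trans; apply: lee_nneseries => [j _ _|j _].
  exact: hausdorff1_ge0.
by rewrite add0e layerL.
Qed.

(** * Measurability and length of segments on the axes *)

Lemma edist_axis {R : realType} {i : 'I_2} {x y : 'rV[R]_2} :
  x 0 (rev_ord i) = y 0 (rev_ord i) -> edist x y = `|x 0 i - y 0 i|.
Proof.
move=> xy; have := edist2 x y i; rewrite xy subrr expr0n addr0 => E.
have e0 : 0 <= edist x y by rewrite /edist /enorm sqrtr_ge0.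
by rewrite -(ger0_norm e0) -!sqrtr_sqr E.
Qed.

Lemma axis_segment_caratheodory {R : realType} (i : 'I_2) (a : R) :
  (@hausdorff1 R 2).-caratheodory (axis_segment i a).
Proof.
(* A maximum of 1-Lipschitz functions, one for each constraint that defines the segment. *)
pose f (x : 'rV[R]_2) : R := Num.max `|x 0 (rev_ord i)| (Num.max (a - x 0 i) (x 0 i - 2 * a)).
have fE x : (f x <= 0) =
    [&& `|x 0 (rev_ord i)| <= 0, a - x 0 i <= 0 & x 0 i - 2 * a <= 0].
  by rewrite /f !ge_max.
have -> : axis_segment i a = [set x | f x <= 0].
  apply/seteqP; split => x; rewrite /mkset fE.
    by move=> [/andP[? ?] ->]; rewrite normr0 lexx; apply/andP; split; lra.
  rewrite normr_le0 => /and3P[/eqP xi ? ?]; split => //; apply/andP; split; lra.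
apply: sublevel_caratheodory => x y.
have := coord_ler_edist x y i; have := coord_ler_edist y x i; rewrite (edistC y).
have := coord_le_edist x y (rev_ord i).
have := ler_normD (x 0 (rev_ord i) - y 0 (rev_ord i)) (y 0 (rev_ord i)).
rewrite subrK => h1 h2 h3 h4.
have : `|y 0 (rev_ord i)| <= f y by rewrite le_max lexx.
have : a - y 0 i <= f y by rewrite !le_max lexx orbT.
have : y 0 i - 2 * a <= f y by rewrite !le_max lexx !orbT.
by move=> h5 h6 h7; rewrite {1}/f !ge_max; apply/and3P; split; lra.
Qed.

Lemma hausdorff1_axis_segment_le {R : realType} (i : 'I_2) (a : R) : 0 < a ->
  (hausdorff1 (axis_segment i a) <= (2 * a)%:E)%E.
Proof.
move=> a0; apply: ge_ereal_sup => _ [d /= d0 <-].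
pose N := (Num.truncn (a / d)).+1.
have aN : a / d < N%:R by apply: truncnS_gt.
have N0 : 0 < N%:R :> R by rewrite ltr0n.
pose w := a / N%:R.
have w0 : 0 < w by rewrite divr_gt0.
have wd : w <= d by rewrite /w ler_pdivrMr// mulrC -ler_pdivrMr// ltW.
have wN : w * N%:R = a by rewrite /w divfK// gt_eqF.
(* The endpoint [2 * a] gets index [N], hence [N.+1] slices of width [w]; their total is
   [a + w <= 2 * a]. *)
pose C k := if (k < N.+1)%N then
  axis_segment i a `&` [set x | a + k%:R * w <= x 0 i <= a + k.+1%:R * w] else set0.
have Cw k : (ediam (C k) <= w%:E)%E.
  rewrite /C; case: ifPn => _; last by rewrite ediam0 lee_fin ltW.
  apply: ediam_le => [|x y [[_ x'] /andP[x1 x2]] [[_ y'] /andP[y1 y2]]]; first exact: ltW.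
  rewrite (edist_axis (i := i)) ?x' ?y'// ler_norml.
  by rewrite -natr1 in x2 y2; apply/andP; split; lra.
apply: (@le_trans _ _ (\sum_(k <oo) ediam (C k))%E).
  apply: ereal_inf_lbound; exists C => //; split=> [k|x xi].
    by rewrite (le_trans (Cw k))// lee_fin.
  have [/andP[x1 x2] x'] := xi.
  have t0 : 0 <= (x 0 i - a) / w by rewrite divr_ge0 ?subr_ge0// ltW.
  exists (Num.truncn ((x 0 i - a) / w)) => //.
  have /andP[k1 k2] := truncn_itv t0.
  rewrite ler_pdivlMr// in k1; rewrite ltr_pdivrMr// in k2.
  rewrite /C ifT.
    by split => //=; apply/andP; split; lra.
  rewrite ltnS -(ler_nat R) -(ler_pM2r w0) (le_trans k1)// [leRHS]mulrC wN; lra.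
rewrite (nneseries_split 0 N.+1); last by move=> *; exact: ediam_ge0.
rewrite eseries0 ?adde0; last first.
  by move=> k; rewrite add0n => Nk _; rewrite /C ltnNge Nk ediam0.
rewrite add0n; apply: (@le_trans _ _ (\sum_(0 <= k < N.+1) w%:E)%E).
  exact: lee_sum.
rewrite sumEFin big_const_nat subn0 iter_addr_0 lee_fin mulrS.
rewrite -[w *+ N]mulr_natr wN mulr_natl mulr2n lerD2r.
rewrite /w ler_pdivrMr//; apply: ler_peMr; [exact: ltW|by rewrite ler1n].
Qed.

(** Projecting to the axis reduces to Lebesgue measure. Each covering set projects into an interval
    centred at one of its points with its diameter as radius, which costs the factor 2. *)
Lemma hausdorff1_axis_segment_ge {R : realType} (i : 'I_2) (a : R) : 0 < a ->
  ((a / 2)%:E <= hausdorff1 (axis_segment i a))%E.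
Proof.
move=> a0; apply: le_trans (hausdorff1_delta_le ltr01).
apply: le_ereal_inf_tmp => _ [C [C1 SC] <-].
have finC k : ediam (C k) \is a fin_num.
  by rewrite ge0_fin_numE ?ediam_ge0// (le_lt_trans (C1 k)) ?ltry.
pose d k := fine (ediam (C k)).
have d0 k : 0 <= d k by rewrite fine_ge0// ediam_ge0.
(* For empty [C k] this is a default point, and the interval around it has length 0. *)
pose q k := (get (C k)) 0 i.
have cov : `[a, 2 * a]%classic `<=` \bigcup_k `[q k - d k, q k + d k]%classic.
  move=> t; rewrite /= in_itv /= => at2.
  pose x : 'rV[R]_2 := \row_j (if j == i then t else 0).
  have xi : x 0 i = t by rewrite mxE eqxx.
  have [|k _ Ckx] := SC x.
    by split; rewrite ?xi// mxE; case: (i) => [[|[|//]] ?].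
  exists k => //; rewrite /= in_itv /=.
  have : `|x 0 i - q k| <= d k.
    rewrite (le_trans (coord_le_edist _ _ _))// -lee_fin fineK//.
    by apply: edist_le_ediam => //; apply: getPex; exists x.
  by rewrite xi ler_norml => /andP[? ?]; apply/andP; split; lra.
have := @measure_sigma_subadditive _ _ _ (@lebesgue_measure R) _ _
  (fun k => measurable_itv `[q k - d k, q k + d k]) (measurable_itv `[a, 2 * a]) cov.
rewrite [leLHS]lebesgue_measure_itv /= lte_fin ifT; last lra.
rewrite -EFinD => le_a.
have : (a%:E <= 2%:E * \sum_(k <oo) ediam (C k))%E.
  rewrite -nneseriesZl; last by move=> *; exact: ediam_ge0.
  have -> : a = 2 * a - a by lra.
  apply: (le_trans le_a); apply: lee_nneseries => [//|k _].
  rewrite [leLHS]lebesgue_measure_itv /= lte_fin -[ediam _]fineK// -/(d k).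
  by case: ifP => _; rewrite -?EFinD -EFinM lee_fin; have := d0 k; lra.
by rewrite muleC EFinM lee_pdivrMr.
Qed.

(** * Curvature energies and tangents *)

Definition pieces {R : realType} : set 'rV[R]_2 := \bigcup_k piece k.

Definition curv_bound {R : realType} (k : nat) : R := 4 / scale k.

Lemma curv_bound_ge1 {R : realType} k : 1 <= curv_bound k :> R.
Proof.
rewrite /curv_bound ler_pdivlMr ?scale_gt0// mul1r.
by have := @scale_le1 R k; lra.
Qed.

Lemma circumradius_pieces_ge {R : realType} {j k l : nat} {x y w : 'rV[R]_2} :
  piece j x -> piece k y -> piece l w -> x <> y -> y <> w -> x <> w ->
  ((curv_bound j * curv_bound k)^-1%:E <= circumradius x y w)%E.
Proof.
move=> jx ky lw xy yw xw; apply: le_ereal_inf_tmp => _ [c [_ [cxy cyw]] <-].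
rewrite lee_fin invfM /curv_bound !invf_div.
exact: circumradius_pieces jx ky lw xy yw xw cxy cyw.
Qed.

Lemma inve_le {R : realType} (r : R) (e : \bar R) :
  0 < r -> (r^-1%:E <= e)%E -> (e^-1 <= r%:E)%E.
Proof.
move=> r0 re; have e0 : (0 <= e)%E by apply: le_trans re; rewrite lee_fin invr_ge0 ltW.
have rE : (r%:E = (r^-1)%:E^-1)%E by rewrite inver invr_eq0 gt_eqF// invrK.
by rewrite rE lee_pV2// inE/= lee_fin invr_ge0 ltW.
Qed.

Lemma curv_boundM_ge1 {R : realType} j k : 1 <= curv_bound j * curv_bound k :> R.
Proof. by rewrite -[leLHS]mulr1 ler_pM// curv_bound_ge1. Qed.

(** The circumradius bound is uniform in the third point, so it survives the infimum. *)
Lemma kappa_i_le {R : realType} {j k : nat} {x y : 'rV[R]_2} :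
  piece j x -> piece k y ->
  (0 <= kappa_i pieces x y <= (curv_bound j * curv_bound k)%:E)%E.
Proof.
move=> jx ky; have jk1 := @curv_boundM_ge1 R j k.
have jk0 : 0 < curv_bound j * curv_bound k :> R by lra.
rewrite /kappa_i; case: ifPn => [_|/eqP xy]; first by rewrite lexx lee_fin ltW.
have le : ((curv_bound j * curv_bound k)^-1%:E <=
    ereal_inf [set circumradius x y w | w in pieces `\` [set x; y]])%E.
  apply: le_ereal_inf_tmp => _ [w [[l _ lw] /not_orP[wx wy]] <-].
  by apply: circumradius_pieces_ge jx ky lw xy _ _ => E; [apply: wy|apply: wx].
rewrite inve_le// andbT inve_ge0 (le_trans _ le)// lee_fin invr_ge0 ltW//.
Qed.

Lemma kappa_le {R : realType} {j k l : nat} {x y z : 'rV[R]_2} :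
  piece j x -> piece k y -> piece l z ->
  (0 <= kappa pieces x y z <= (curv_bound j * curv_bound k)%:E)%E.
Proof.
move=> jx ky lz; have jk1 := @curv_boundM_ge1 R j k.
have jk0 : 0 < curv_bound j * curv_bound k :> R by lra.
rewrite /kappa; case: asboolP => [[_ [xy yz xz]]|_]; last by rewrite lexx lee_fin ltW.
have le := circumradius_pieces_ge jx ky lz xy yz xz.
by rewrite inve_le// andbT inve_ge0 (le_trans _ le)// lee_fin invr_ge0 ltW.
Qed.

Lemma poweR_le_exp {R : realType} (u : \bar R) (K p : R) (m : nat) :
  1 <= K -> 0 < p -> p <= m%:R -> (0 <= u <= K%:E)%E ->
  (u `^ p <= (K ^+ m)%:E)%E.
Proof.
move=> K1 p0 pm /andP[u0 uK]; have K0 : 0 <= K by lra.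
apply: (@le_trans _ _ (K%:E `^ p)%E).
  apply: gt0_ler_poweR => //; [exact: ltW|by rewrite in_itv/= u0 leey|].
  by rewrite in_itv/= lee_fin K0 leey.
by rewrite poweR_EFin lee_fin -powR_mulrn// ler_powR.
Qed.

(** * Integrable weights and finiteness of the energies *)

Definition caratheodory_measure {R : realType} {T : pointedType}
    (mu : {outer_measure set T -> \bar R}) :
    {measure set (caratheodory_type mu) -> \bar R} :=
  (mu : set (caratheodory_type mu) -> \bar R).

Lemma outer_integral_le {R : realType} {T : pointedType}
    (mu : {outer_measure set T -> \bar R}) (X : set T) (f : T -> \bar R)
    (g : caratheodory_type mu -> \bar R) :
  measurable_fun setT g -> (forall x, 0 <= g x)%E -> (forall x, X x -> f x <= g x)%E ->
  (outer_integral mu X f <=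
   \int[caratheodory_measure mu]_x g x)%E.
Proof. by move=> mg g0 fg; apply: ereal_inf_lbound; exists g. Qed.

(* The m-th power bounds curvatures to any real exponent p <= m, as [curv_bound] >= 1. *)
Definition weight {R : realType} (m : nat) (x : 'rV[R]_2) : \bar R :=
  (\sum_(k <oo) (curv_bound k ^+ m * \1_(piece k) x)%:E)%E.

Lemma curv_boundX_ge1 {R : realType} m k : 1 <= curv_bound k ^+ m :> R.
Proof. by rewrite exprn_ege1// curv_bound_ge1. Qed.

Lemma weight_term_ge0 {R : realType} m k (x : 'rV[R]_2) :
  (0 <= (curv_bound k ^+ m * \1_(piece k) x : R)%:E)%E.
Proof.
by rewrite lee_fin mulr_ge0 ?indicE// (le_trans ler01)// curv_boundX_ge1.
Qed.

Lemma weight_ge0 {R : realType} m (x : 'rV[R]_2) : (0 <= weight m x)%E.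
Proof. by apply: nneseries_ge0 => k _ _; exact: weight_term_ge0. Qed.

Lemma weight_ge {R : realType} m {k} {x : 'rV[R]_2} : piece k x ->
  ((curv_bound k ^+ m)%:E <= weight m x)%E.
Proof.
move=> kx; apply: le_trans (nneseries_lim_ge k.+1 _); last first.
  by move=> n _ _; exact: weight_term_ge0.
rewrite big_nat_recr//= indicE mem_set// mulr1 leeDr// sume_ge0// => n _.
exact: weight_term_ge0.
Qed.

Lemma weight_term_measurable {R : realType} m k :
  measurable_fun setT
    (fun x : caratheodory_type (@hausdorff1 R 2) =>
       (curv_bound k ^+ m * \1_(piece k) x : R)%:E).
Proof.
apply/measurable_EFinP; apply: measurable_funM; first exact: measurable_cst.
by apply: measurable_indic; exact: axis_segment_caratheodory.
Qed.

Lemma weight_measurable {R : realType} m :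
  measurable_fun setT (weight m : caratheodory_type (@hausdorff1 R 2) -> \bar R).
Proof.
apply: (@ge0_emeasurable_sum _ _ _ _ _ predT) => [k x _ _|k _].
  exact: weight_term_ge0.
exact: weight_term_measurable.
Qed.

(** With [t = scale k / 4] the left side is [2 * t ^+ (k.+1 - m)], so at least one factor
    [t <= 4^-1 ^+ k.+1] remains. The growing exponent in [scale] is what beats every [m]. *)
Lemma curv_bound_scale_le {R : realType} m k : (m <= k)%N ->
  curv_bound k ^+ m * (2 * scale k.+1) <= 1 / (2 ^ k.+1)%:R :> R.
Proof.
move=> mk; have s0 := @scale_gt0 R k; have s1 := @scale_le1 R k.
have -> : curv_bound k ^+ m * (2 * scale k.+1) = 2 * (scale k / 4) ^+ (k - m).+1 :> R.
  have -> : curv_bound k = (scale k / 4)^-1 :> R by rewrite invf_div.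
  have t0 : scale k / 4 != 0 :> R by rewrite gt_eqF// divr_gt0.
  have -> : scale k.+1 = (scale k / 4) ^+ (k - m).+1 * (scale k / 4) ^+ m :> R.
    by rewrite -exprD addSn subnK.
  by rewrite mulrA mulrC exprVn mulrA mulfK ?expf_neq0// mulrC.
rewrite exprS; apply: (@le_trans _ _ (2 * (scale k / 4 * 1))).
  rewrite ler_pM2l// ler_pM2l ?divr_gt0// exprn_ile1//; lra.
have [_ s4] := @scale_bounds R k.
have h2 : 4^-1 ^+ k <= 2^-1 ^+ k :> R.
  by rewrite lerXn2r ?nnegrE//; lra.
rewrite natrX exprS mul1r invfM -exprVn; lra.
Qed.

Lemma integral_weight_lty {R : realType} m :
  (\int[caratheodory_measure (@hausdorff1 R 2)]_x weight m x < +oo)%E.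
Proof.
have -> : (\int[caratheodory_measure (@hausdorff1 R 2)]_x weight m x =
    \sum_(k <oo) \int[caratheodory_measure (@hausdorff1 R 2)]_x
      (curv_bound k ^+ m * \1_(piece k) x)%:E)%E.
  apply: (@integral_nneseries _ _ _ (caratheodory_measure (@hausdorff1 R 2)) setT measurableT
    (fun k x => (curv_bound k ^+ m * \1_(piece k) x)%:E)).
- by move=> k; exact: weight_term_measurable.
- by move=> k x _; exact: weight_term_ge0.
(* [A] carries the finitely many terms before the geometric bound takes effect. *)
pose A k : \bar R := (if (k < m)%N then curv_bound k ^+ m * (2 * scale k.+1) else 0)%:E.
have A0 k : (0 <= A k)%E.
  rewrite lee_fin; case: ifP => // _; have := @curv_boundX_ge1 R m k.
  by have := @scale_gt0 R k.+1; nra.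
apply: (@le_lt_trans _ _ (\sum_(k <oo) (A k + (1 / (2 ^ k.+1)%:R)%:E))%E).
  apply: lee_nneseries => [k _ _|k _].
    by apply: integral_ge0 => x _; exact: weight_term_ge0.
  have mk : (measurable (piece k : set (caratheodory_type (@hausdorff1 R 2)))).
    exact: axis_segment_caratheodory.
  rewrite (integralZl_indic measurableT
    (fun=> piece k : set (caratheodory_type (@hausdorff1 R 2)))); last 2 first.
  - by move=> h; exfalso; have := @curv_boundX_ge1 R m k; lra.
  - exact: mk.
  rewrite (integral_indic _ measurableT mk) setIT.
  apply: (@le_trans _ _ ((curv_bound k ^+ m)%:E * (2 * scale k.+1)%:E)%E).
    apply: lee_wpmul2l; last exact: hausdorff1_axis_segment_le (scale_gt0 _).
    by rewrite lee_fin (le_trans ler01)// curv_boundX_ge1.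
  rewrite -EFinM /A -EFinD lee_fin; case: ltnP => km.
    by rewrite lerDl.
  by rewrite add0r curv_bound_scale_le.
apply: (le_lt_trans (epsilon_trick xpredT A0 ler01)).
rewrite (nneseries_split 0 m) => [|k _]; last exact: A0.
rewrite add0n [X in (_ + X + _)%E]eseries0 => [|k mk _]; last by rewrite /A ltnNge mk.
by rewrite adde0 sumEFin -EFinD ltry.
Qed.

(** Peels off one integral of an iterated upper integral; [c] collects the weights of the outer
    variables and the integrals still to be evaluated, so it is extended real. *)
Lemma outer_integral_weight_le {R : realType} m (X : set 'rV[R]_2)
    (f : 'rV[R]_2 -> \bar R) (c : \bar R) :
  (0 <= c)%E -> (forall x, X x -> f x <= weight m x * c)%E ->
  (outer_integral (@hausdorff1 R 2) X f <=
   \int[caratheodory_measure (@hausdorff1 R 2)]_x weight m x * c)%E.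
Proof.
move=> c0 fc; have mw := @weight_measurable R m.
have <- := @ge0_integralZr _ _ _ (caratheodory_measure (@hausdorff1 R 2)) setT
  measurableT (weight m) mw c (fun x _ => weight_ge0 m x) c0.
apply: outer_integral_le => [|x|//].
  by apply: emeasurable_funM; [exact: mw|exact: measurable_cst].
by rewrite mule_ge0// weight_ge0.
Qed.

Lemma curv_bound_weight_le {R : realType} m {j k} {x y : 'rV[R]_2} :
  piece j x -> piece k y ->
  (((curv_bound j * curv_bound k) ^+ m)%:E <= weight m x * weight m y)%E.
Proof.
move=> jx ky; rewrite exprMn EFinM; apply: lee_pmul; rewrite ?weight_ge//.
- by rewrite lee_fin (le_trans ler01)// curv_boundX_ge1.
- by rewrite lee_fin (le_trans ler01)// curv_boundX_ge1.
Qed.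

Lemma energy_I_lty {R : realType} (p : R) : 0 < p -> (energy_I p pieces < +oo)%E.
Proof.
move=> p0; pose m := (Num.truncn p).+1.
have pm : p <= m%:R by rewrite ltW// truncnS_gt.
have Wlty := @integral_weight_lty R m.
set W := integral _ _ _ in Wlty.
have W0 : (0 <= W)%E by apply: integral_ge0 => x _; exact: weight_ge0.
apply: (@le_lt_trans _ _ (W * W)%E); last first.
  by rewrite lte_mul_pinfty// ge0_fin_numE.
apply: outer_integral_weight_le => // y [k _ ky].
rewrite muleC; apply: outer_integral_weight_le => [|x [j _ jx]].
  exact: weight_ge0.
apply: le_trans (curv_bound_weight_le m jx ky).
by apply: poweR_le_exp => //; [exact: curv_boundM_ge1|exact: kappa_i_le].
Qed.

Lemma energy_M_lty {R : realType} (p : R) : 0 < p -> (energy_M p pieces < +oo)%E.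
Proof.
move=> p0; pose m := (Num.truncn p).+1.
have pm : p <= m%:R by rewrite ltW// truncnS_gt.
have Wlty := @integral_weight_lty R m.
set W := integral _ _ _ in Wlty.
have W0 : (0 <= W)%E by apply: integral_ge0 => x _; exact: weight_ge0.
apply: (@le_lt_trans _ _ (W * (W * W))%E); last first.
  by rewrite !lte_mul_pinfty ?mule_ge0// ?ge0_fin_numE.
apply: outer_integral_weight_le => [|z [l _ lz]]; first exact: mule_ge0.
rewrite muleCA; apply: outer_integral_weight_le => [|y [k _ ky]].
  by rewrite mule_ge0 ?weight_ge0.
rewrite muleA muleC; apply: outer_integral_weight_le => [|x [j _ jx]].
  by rewrite mule_ge0 ?weight_ge0.
(* The bound on [kappa] does not involve [z]; the factor [weight m z] makes the integral over [z]
   finite as well. *)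
have z1 : (1 <= weight m z)%E.
  by apply: le_trans (weight_ge m lz); rewrite lee_fin curv_boundX_ge1.
rewrite muleA; apply: (@le_trans _ _ (weight m x * weight m y)%E); last first.
  by rewrite lee_pemulr// mule_ge0 ?weight_ge0.
apply: le_trans (curv_bound_weight_le m jx ky).
by apply: poweR_le_exp => //; [exact: curv_boundM_ge1|exact: (kappa_le jx ky lz)].
Qed.

(** * No approximate tangent at the origin *)

Lemma enorm_axis {R : realType} {i : 'I_2} {x : 'rV[R]_2} :
  0 <= x 0 i -> x 0 (rev_ord i) = 0 -> enorm x = x 0 i.
Proof.
move=> x0 x'; rewrite /enorm (dotv2 _ _ i) x' mulr0 addr0 -expr2 sqrtr_sqr.
by rewrite ger0_norm.
Qed.

Lemma angle_axis {R : realType} {i : 'I_2} {x s : 'rV[R]_2} :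
  0 < x 0 i -> x 0 (rev_ord i) = 0 -> enorm s = 1 -> angle x 0 s = acos (s 0 i).
Proof.
move=> x0 x' s1; rewrite /angle !subr0 s1 mulr1 (enorm_axis (ltW x0) x').
by rewrite (dotv2 _ _ i) x' mul0r addr0 mulrAC divff ?mul1r// gt_eqF.
Qed.

(** Two coordinates of modulus at least 1 would give a squared norm of at least 2. The chosen axis
    is not parallel to [s]. *)
Lemma unit_coord_lt1 {R : realType} (s : 'rV[R]_2) :
  enorm s = 1 -> exists i : 'I_2, -1 < s 0 i < 1.
Proof.
move=> s1; have : dotv s s = 1.
  rewrite -[RHS](expr1n _ 2) -s1 /enorm sqr_sqrtr//.
  by rewrite sumr_ge0// => i _; rewrite -expr2 sqr_ge0.
rewrite (dotv2 _ _ ord0) -!expr2 => ss.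
have [s0|s0] := boolP (-1 < s 0 ord0 < 1); first by exists ord0.
exists (rev_ord ord0); apply/andP.
have : 1 <= s 0 ord0 ^+ 2.
  by move: s0; rewrite negb_and -!leNgt => /orP[]; nra.
by split; nra.
Qed.

Lemma pieces_axis_small {R : realType} (i : 'I_2) (e : R) : 0 < e ->
  exists2 k, axis k = i & 2 * scale k.+1 < e.
Proof.
move=> e0; have e2 : 0 < e / 2 by lra.
(* Adding [i] to an even number selects the parity that belongs to axis [i]. *)
have [N] := ltr_add_invr e2; rewrite add0r => Ne; exists (N.*2 + i)%N.
  rewrite /axis oddD odd_double /=.
  by case: i => [[|[|//]] ?]; apply: val_inj.
have : scale (N.*2 + i).+1 <= scale N :> R.
  by apply: scale_le; lia.
have := le_lt_trans (scale_le_inv N) Ne; lra.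
Qed.

Lemma pieces_no_tangent {R : realType} :
  ~ has_approx_tangent (@pieces R) (0 : 'rV[R]_2).
Proof.
move=> [s [s1 lim]]; have [i /andP[is1 si1]] := unit_coord_lt1 _ s1.
have Ns1 : enorm (- s) = 1.
  rewrite -s1 /enorm /dotv; congr Num.sqrt; apply: eq_bigr => j _.
  by rewrite !mxE mulrNN.
(* This is exactly the smaller angle between the positive axis [i] and the directions [-s], [s]; the
   cone is open, so it misses every segment on that axis. *)
pose e := Num.min (acos (- s 0 i)) (acos (s 0 i)).
have e0 : 0 < e by rewrite /e lt_min !acos_gt0//; apply/andP; split; lra.
(* At radius [2 * a] a segment of measure at least [a / 2] lies outside the cone, so the quotient is
   at least [(a / 2) / (4 * a) = 1/8]. *)
have lt8 : nbhs (0%:E : \bar R) [set y | (y < (8^-1)%:E)%E].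
  by apply: (@nbhs_open_ereal_lt _ _ (fun=> 8^-1)); rewrite invr_gt0.
have /nbhs_ballP[d /= d0 near0] := lim _ e0 _ lt8.
have [k ki kd] := @pieces_axis_small R i d d0.
have a0 := @scale_gt0 R k.+1.
have r0 : 0 < 2 * scale k.+1 :> R by lra.
have := near0 (2 * scale k.+1); rewrite /ball/= sub0r normrN gtr0_norm//.
move=> /(_ kd r0) /=; apply/negP; rewrite -leNgt.
apply: (@le_trans _ _ ((scale k.+1 / 2)%:E / (2 * (2 * scale k.+1))%:E)%E).
  rewrite inver gt_eqF; last lra.
  by rewrite -EFinM lee_fin (_ : _ / _ / _ = 8^-1)//; field; lra.
apply: lee_wpmul2r; first by rewrite inve_ge0 lee_fin; lra.
apply: (le_trans (hausdorff1_axis_segment_ge i _ a0)).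
apply: le_hausdorff1 => x xS; have [/andP[x1 x2] x'] := xS.
have x0 : 0 < x 0 i by lra.
split; first split.
- by exists k => //; rewrite /piece ki.
- move=> [_]; rewrite sub0r add0r (angle_axis x0 x' s1) (angle_axis x0 x' Ns1).
  by rewrite mxE ltxx.
- by rewrite /closed_eball /= /edist subr0 (enorm_axis (ltW x0) x').
Qed.

Theorem proposition1p3 (R : realType) :
  exists (n : nat) (F : set 'rV[R]_n) (x : 'rV[R]_n),
    [/\ (0 < n)%N,
        ~ has_approx_tangent F x,
        forall p : R, 0 < p -> (energy_I p F < +oo)%E
      & forall p : R, 0 < p -> (energy_M p F < +oo)%E].
Proof.
exists 2%N, pieces, 0; split=> //.
- exact: pieces_no_tangent.
- exact: energy_I_lty.
- exact: energy_M_lty.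
Qed.
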